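(* Let $f$ be a monic complex polynomial of degree $n \ge 2$, $1 \le p \le \infty$ and $1/p + 1/q = 1$. Define the real function $$\phi(x) = \frac{a x^2}{(1 - (a + 1) x) (1 - (a + b) x)} \left(1 + \frac{1}{n-1} \cdot \frac{ax}{1 - (a + b) x} \right)^{n - 1},$$ where $a = (n - 1)^{1/q}$ and $b = 2^{1/q}$. Suppose that $z^0$ is an initial point in $\mathbb{C}^n$ with distinct components satisfying $$E(z^0) < 1/(a + b) \quad\text{and}\quad \phi(E(z^0)) \le 1.$$ Define also $\psi(x) = \dfrac{1 - (a + b) x}{1 - a x}$ and $\mu(x) = \dfrac{1}{1 - a x}$. Then the following statements hold true. 1. Ehrlich's iterative sequence $z^{k+1} = F(z^k)$, $k=0,1,2,\ldots$, is well-defined and convergent to a root-vector $\xi$ of $f$. Moreover, if $\phi(E(z^0)) < 1$, then the order of convergence is three. 2. For each $k \ge 1$ we have the a priori error estimate $$\left\| z^k - \xi \right\|_p \le A_k \, \frac{\theta^k \lambda^{(3^k - 1)/2}}{1 - \theta \lambda^{3^k}} \left\| W(z^0) \right\|_p,$$ where $\lambda = \phi(E(z^0))$, $\theta = \psi(E(z^0))$ and $A_k = \mu\left(E(z^0) \lambda^{(3^k - 1)/2}\right)$. 3. For all $k \ge 0$ we have the a posteriori error estimate $$\left\| z^k - \xi \right\|_p \le \frac{\mu_k}{1 - \theta_k \lambda_k} \left\| W(z^k) \right\|_p,$$ where $\lambda_k = \phi(E(z^k))$, $\theta_k = \psi(E(z^k))$ and $\mu_k = \mu(E(z^k))$.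
   Context: $\|z\|_p = \left(\sum_{i=1}^n |z_i|^p\right)^{1/p}$ is the usual $p$-norm on $\mathbb{C}^n$ (maximum norm for $p=\infty$), and $1/\infty = 0$. A point $\xi\in\mathbb{C}^n$ is a root-vector of $f$ if its components are exactly the zeros of $f$ with their multiplicities. For a point $z=(z_1,\ldots,z_n) \in \mathbb{C}^n$ with distinct components, set, for $i=1,\ldots,n$, $$W_i(z) = \frac{f(z_i)}{\prod_{j \ne i}(z_i - z_j)}, \qquad W(z) = (W_1(z),\ldots,W_n(z)), \qquad d_i(z) = \min\{|z_i - z_j| : j \ne i\},$$ $$\frac{W(z)}{d(z)} = \left(\frac{W_1(z)}{d_1(z)}, \ldots, \frac{W_n(z)}{d_n(z)}\right), \qquad E(z) = \left\| \frac{W(z)}{d(z)} \right\|_p .$$ Ehrlich's iteration is $z^{k+1} = F(z^k)$, where $F(z) = (F_1(z),\ldots,F_n(z))$ with $$F_i(z) = z_i - \frac{f(z_i)}{f'(z_i) - f(z_i) \sum_{j \ne i} 1/(z_i - z_j)},$$ which can also be written (Werner) in the form $$F_i(z) = z_i - \frac{W_i(z)}{1 + \sum_{j \ne i} W_j(z)/(z_i - z_j)}.$$ *)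

(* Defs.v *)
From mathcomp Require Export all_boot all_order all_algebra complex.
From mathcomp Require Export all_classical all_reals all_analysis.

Set Implicit Arguments.
Unset Strict Implicit.
Unset Printing Implicit Defensive.

Export Order.TTheory GRing.Theory Num.Theory.
Export numFieldNormedType.Exports.

Local Open Scope classical_set_scope.
Local Open Scope complex_scope.
Local Open Scope ring_scope.

Notation cabs := ComplexField.Normc.normc.

Section PNorm.
Variable R : realType.

(* The catch-all branch is reached only by +oo, since p >= 1 in all uses. *)
Definition pnorm (p : \bar R) (n : nat) (z : 'rV[R[i]]_n) : R :=
  match p with
  | r%:E => (\sum_(i < n) cabs (z 0 i) `^ r) `^ r^-1
  | _ => \big[Num.max/0]_(i < n) cabs (z 0 i)
  end.

(* Q-order (at least) r of a sequence u converging to xi. *)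
Definition has_order_of_convergence (p : \bar R) (n : nat)
    (u : nat -> 'rV[R[i]]_n) (xi : 'rV[R[i]]_n) (r : nat) : Prop :=
  exists C : R, \forall k \near \oo,
    pnorm p (u k.+1 - xi) <= C * pnorm p (u k - xi) ^+ r.

End PNorm.

Section Ehrlich.
Variables (R : realType) (n : nat) (f : {poly R[i]}).
Implicit Types z xi : 'rV[R[i]]_n.

Definition root_vector xi : Prop :=
  forall c : R[i], #|[set i : 'I_n | xi 0 i == c]%SET| = mup c f.

Definition distinct_components z : Prop := injective (z 0).

Definition weierstrass z : 'rV[R[i]]_n :=
  \row_i (f.[z 0 i] / \prod_(j < n | j != i) (z 0 i - z 0 j)).

(* For n >= 2 the set is finite and nonempty, so that inf is a minimum. *)
Definition sep z (i : 'I_n) : R :=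
  inf [set cabs (z 0 i - z 0 j) | j in [set j : 'I_n | j != i]].

Definition Efun (p : \bar R) z : R :=
  pnorm p (\row_i (weierstrass z 0 i / (sep z i)%:C)).

Definition ehrlich_denom z (i : 'I_n) : R[i] :=
  f^`().[z 0 i] - f.[z 0 i] * \sum_(j < n | j != i) (z 0 i - z 0 j)^-1.

Definition ehrlich z : 'rV[R[i]]_n :=
  \row_i (z 0 i - f.[z 0 i] / ehrlich_denom z i).

(* Division is total, so the domain of the iteration function [ehrlich] is
   recorded separately: no division by zero occurs in any component. *)
Definition ehrlich_defined z : Prop :=
  distinct_components z /\ forall i, ehrlich_denom z i != 0.

End Ehrlich.

Section RealFunctions.
Variable R : realType.
Implicit Types a b x : R.

Definition phi (n : nat) a b x : R :=
  a * x ^+ 2 / ((1 - (a + 1) * x) * (1 - (a + b) * x)) *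
  (1 + (n.-1%:R)^-1 * (a * x / (1 - (a + b) * x))) ^+ n.-1.

Definition psi a b x : R := (1 - (a + b) * x) / (1 - a * x).

Definition mu a x : R := (1 - a * x)^-1.

End RealFunctions.

(* Main.v *)
Require Import Defs.
From mathcomp Require Import ring lra zify.

(** Ehrlich's step annihilates the first-order part of the Lagrange expansion
    of [f] at the current nodes,
      [f = prod_j ('X - z j) + sum_k W k * prod_(j != k) ('X - z j)].
    Evaluated at the new component [x = F_i z], this expansion collapses to
      [- (x - z i) ^ 2 * (sum_(k != i) W k / ((x - z k) * (z i - z k)))
         * prod_(j != i) (x - z j)]
    ([horner_ehrlich_step]). As [x - z i] is itself of the size of [W i], the
    new correction is of third order.

    Write [h i = |W i| / d i] and [E] for the [p]-norm of [h]. Hoelder's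
    inequality ([sum_cabs_le_pnorm]) gives [sum_(j != i) h j <= a * E] and
    [h i + h j <= b * E]. These two bounds turn the exact formula into
      [|F_i z - z i| <= mu(E) * |W i|],
      [|F_i z - F_j z| >= psi(E) * |z i - z j|],
      [|W_i (F z)| <= psi(E) * phi(E) * |W i|],
    and, dividing the third by the second, [E (F z) <= phi(E) * E]. Since [phi]
    is [x ^ 2] times an increasing function, [phi (s * x) <= s ^ 2 * phi x]
    for [s <= 1], and induction yields
      [E (z^k) <= lambda ^ ((3 ^ k - 1) / 2) * E (z^0)]
    as well as the matching bounds for [W (z^k)] ([weierstrass_iter_le]).

    The displacements are therefore dominated by a geometric series with ratio
    [theta * lambda < 1]; the iterates converge, and summing the series from any
    iterate on gives the a posteriori estimate, componentwise ([ehrlich_error])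
    and hence for the norm. The a priori estimate follows by inserting the
    bounds on [E (z^k)] and [W (z^k)]. In the limit the corrections vanish in
    the Lagrange expansion, so [f] is the product of the ['X - xi j].

    When [lambda < 1], the a posteriori estimate also forces the components of
    [xi] to be distinct ([limit_distinct]). The separations of the iterates are
    then bounded from below, [W (z^k)] and [E (z^k)] are bounded by multiples of
    the error of [z^k], and the third-order bound on the corrections becomes a
    third-order bound on the errors. *)

Set Implicit Arguments.
Unset Strict Implicit.
Unset Printing Implicit Defensive.

Local Open Scope classical_set_scope.
Local Open Scope complex_scope.
Local Open Scope ring_scope.

(** * The real-valued modulus *)

Section Cabs.
Variable R : realType.
Implicit Types x y : R[i].

Lemma cabsE x : `|x| = (cabs x)%:C.
Proof. by case: x => a b; rewrite normc_def. Qed.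

Lemma cabs_ge0 x : 0 <= cabs x.
Proof. by case: x => a b; exact: sqrtr_ge0. Qed.

Lemma cabs0 : cabs (0 : R[i]) = 0. Proof. exact: ComplexField.Normc.normc0. Qed.

Lemma cabs1 : cabs (1 : R[i]) = 1. Proof. exact: ComplexField.Normc.normc1. Qed.

Lemma cabs_eq0 x : (cabs x == 0) = (x == 0).
Proof.
by apply/eqP/eqP => [/ComplexField.Normc.eq0_normc //|->]; rewrite cabs0.
Qed.

Lemma cabs_gt0 x : (0 < cabs x) = (x != 0).
Proof. by rewrite lt_def cabs_ge0 andbT cabs_eq0. Qed.

Lemma cabsM x y : cabs (x * y) = cabs x * cabs y.
Proof. exact: ComplexField.Normc.normcM. Qed.

Lemma cabsV x : cabs x^-1 = (cabs x)^-1.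
Proof. exact: ComplexField.Normc.normcV. Qed.

Lemma cabsN x : cabs (- x) = cabs x.
Proof. by have := normrN x; rewrite !cabsE => -[]. Qed.

Lemma cabs_distC x y : cabs (x - y) = cabs (y - x).
Proof. by rewrite -cabsN opprB. Qed.

Lemma cabsD x y : cabs (x + y) <= cabs x + cabs y.
Proof. by rewrite -lecR rmorphD /= -!cabsE ler_normD. Qed.

Lemma cabs_real (r : R) : 0 <= r -> cabs r%:C = r.
Proof. by move=> r0; rewrite /= expr0n addr0 sqrtr_sqr ger0_norm. Qed.

Lemma cabs_tri x y z : cabs (x - z) <= cabs (x - y) + cabs (y - z).
Proof. by rewrite -{1}(subrK y x) -addrA cabsD. Qed.

Lemma cabs_sum (I : Type) (r : seq I) (P : pred I) (F : I -> R[i]) :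
  cabs (\sum_(i <- r | P i) F i) <= \sum_(i <- r | P i) cabs (F i).
Proof.
elim/big_rec2: _ => [|i s c _ IH]; first by rewrite cabs0.
by apply: le_trans (cabsD _ _) _; rewrite lerD2l.
Qed.

Lemma cabs_prod (I : Type) (r : seq I) (P : pred I) (F : I -> R[i]) :
  cabs (\prod_(i <- r | P i) F i) = \prod_(i <- r | P i) cabs (F i).
Proof. exact: (big_morph _ cabsM cabs1). Qed.

End Cabs.

(** * The p-norm *)

Section Pnorm.
Variables (R : realType) (p q : \bar R).
Hypotheses (p1 : (1 <= p)%E) (pq : (p^-1 + q^-1 = 1)%E).
Let t : R := fine (q^-1)%E.

(** Young's inequality for the product of [s] and [1], cleared of its
    denominators: the tangent line of [s `^ r] at [1] lies below the graph. *)
Lemma bernoulli_powR (r s : R) : 1 <= r -> 0 <= s -> 1 + r * (s - 1) <= s `^ r.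
Proof.
rewrite le_eqVlt => /predU1P[<- s0|r1 s0]; first by rewrite powRr1 //; lra.
have r0 : 0 < r by lra.
have ri0 : 0 < r - 1 by lra.
have /= := @conjugate_powR R s 1 r (r / (r - 1)) s0 ler01 r0.
rewrite powR1 mulr1 => /(_ (divr_gt0 r0 ri0)) H.
have /H {}H : r^-1 + (r / (r - 1))^-1 = 1 by field; lra.
rewrite -(ler_pM2l r0) in H; apply: le_trans (_ : r * s - (r - 1) <= _).
  by lra.
rewrite lerBlDr; apply: le_trans H _; rewrite le_eqVlt; apply/orP; left.
by apply/eqP; field; lra.
Qed.

(** Conjugacy only pins down [q] through its inverse: for [p = 1] that inverse
    is [0], so [fine] never meets an infinite value. *)
Lemma conj_fine : (exists2 r, p = r%:E & 1 <= r /\ t = 1 - r^-1) \/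
  (p = +oo%E /\ t = 1).
Proof.
rewrite /t; move: p1 pq; case: p => [r|_|//].
- rewrite lee_fin => r1; rewrite inver gt_eqF; last by lra.
  move=> H; left; exists r => //; split=> //.
  case: (q^-1)%E H => [s /= []||] //; rewrite /fine => <-; lra.
- rewrite invey add0e => ->; right; split=> //.
Qed.

Lemma conj_exp_ge0 : 0 <= t.
Proof.
case: conj_fine => [[r _ [r1 ->]]|[_ ->]] //.
by rewrite subr_ge0 invf_le1 //; lra.
Qed.

Variable n : nat.
Implicit Types u v : 'rV[R[i]]_n.

Lemma pnorm_ge0 u : 0 <= pnorm p u.
Proof.
case: conj_fine => [[r -> _]|[-> _]] /=; first exact: powR_ge0.
by apply: le_trans (bigmax_ge_id _ _ _ _).
Qed.

Lemma le_cabs_pnorm u i : cabs (u 0 i) <= pnorm p u.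
Proof.
case: conj_fine => [[r -> [r1 _]]|[-> _]] /=; last exact: le_bigmax.
have r0 : 0 < r by lra.
rewrite -[leLHS]powRr1 ?cabs_ge0 // -(@mulfV _ r) ?gt_eqF // powRrM.
apply: ge0_ler_powR; rewrite ?nnegrE ?powR_ge0 ?invr_ge0 ?(ltW r0) //.
  by apply: sumr_ge0 => j _; exact: powR_ge0.
by rewrite (bigD1 i) //= lerDl; apply: sumr_ge0 => j _; exact: powR_ge0.
Qed.

(** The estimates on the iteration hold entry by entry; this domination
    principle transfers them to norms. *)
Lemma pnorm_le (C : R) u v : 0 <= C ->
  (forall i, cabs (u 0 i) <= C * cabs (v 0 i)) -> pnorm p u <= C * pnorm p v.
Proof.
move=> C0 uv; case: conj_fine => [[r -> [r1 _]]|[-> _]] /=.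
  have r0 : 0 < r by lra.
  have s0 w : 0 <= \sum_(i < n) cabs (w 0 i : R[i]) `^ r.
    by apply: sumr_ge0 => j _; exact: powR_ge0.
  rewrite -{1}[C]powRr1 // -(@mulfV _ r) ?gt_eqF // powRrM.
  rewrite -powRM ?powR_ge0 //.
  apply: ge0_ler_powR;
    rewrite ?nnegrE ?invr_ge0 ?(ltW r0) ?mulr_ge0 ?powR_ge0 //.
  rewrite mulr_sumr; apply: ler_sum => i _.
  rewrite -powRM ?cabs_ge0 //; apply: ge0_ler_powR;
    by rewrite ?nnegrE ?mulr_ge0 ?cabs_ge0 ?(ltW r0).
apply: bigmax_le => [|i _].
  by rewrite mulr_ge0 // (le_trans _ (bigmax_ge_id _ _ _ _)).
apply: le_trans (uv i) _; rewrite ler_wpM2l //; exact: le_bigmax.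
Qed.

(** Hoelder's inequality against the indicator function of [A]. The constants
    of the theorem come from here: [a] when [A] omits one index, and [b] when
    [A] is a pair. *)
Lemma sum_cabs_le_pnorm (A : {pred 'I_n}) u :
  \sum_(i in A) cabs (u 0 i) <= #|A|%:R `^ t * pnorm p u.
Proof.
have [A0|A0] := eqVneq #|A| 0%N.
  rewrite big_pred0; first by rewrite mulr_ge0 ?powR_ge0 ?pnorm_ge0.
  exact: card0_eq.
have {}A0 : 0 < #|A|%:R :> R by rewrite ltr0n lt0n.
case: conj_fine => [[r -> [r1 ->]]|[-> ->]] /=; last first.
  rewrite powRr1 ?ler0n // mulr_natl -sumr_const; apply: ler_sum => i _.
  exact: le_bigmax.
have r0 : 0 < r by lra.
set m := #|A|%:R in A0 *; set S := \sum_(i in A) _.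
set T := \sum_(i < n) _.
have S0 : 0 <= S by apply: sumr_ge0 => i _; exact: cabs_ge0.
have T0 : 0 <= T by apply: sumr_ge0 => i _; exact: powR_ge0.
have [S00|Sn0] := eqVneq S 0; first by rewrite S00 mulr_ge0 ?powR_ge0.
have Sp : 0 < S by rewrite lt_def Sn0.
have sp : 0 < S / m by exact: divr_gt0.
(* Bernoulli's inequality at the ratios u_i / mean, summed over A *)
have key : m * (S / m) `^ r <= T.
  apply: (@le_trans _ _ (\sum_(i in A) cabs (u 0 i) `^ r)); last first.
    rewrite /T [leRHS](bigID (mem A)) /= lerDl.
    by apply: sumr_ge0 => i _; exact: powR_ge0.
  have -> : m * (S / m) `^ r =
      \sum_(i in A) (1 + r * (cabs (u 0 i) / (S / m) - 1)) * (S / m) `^ r.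
    rewrite -mulr_suml big_split /= -mulr_sumr sumrB -mulr_suml !sumr_const.
    rewrite -/m -/S; congr (_ * _).
    by field; rewrite Sn0 gt_eqF.
  apply: ler_sum => i _.
  have -> : cabs (u 0 i) `^ r = (cabs (u 0 i) / (S / m)) `^ r * (S / m) `^ r.
    by rewrite -powRM ?divfK ?gt_eqF // ?divr_ge0 ?cabs_ge0 // ltW.
  rewrite ler_wpM2r ?powR_ge0 // bernoulli_powR // divr_ge0 ?cabs_ge0 //.
  exact: ltW.
have : (m * (S / m) `^ r) `^ r^-1 <= T `^ r^-1.
  apply: ge0_ler_powR => //; rewrite ?nnegrE ?invr_ge0 ?(ltW r0) //.
  by rewrite mulr_ge0 ?powR_ge0 // ltW.
rewrite powRM ?powR_ge0 ?(ltW A0) // -powRrM mulfV ?gt_eqF //.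
rewrite powRr1 ?(ltW sp) //.
rewrite -(ler_pM2l (powR_gt0 (1 - r^-1) A0)) [leLHS]mulrA -powRD; last first.
  by rewrite (gt_eqF A0) implybT.
by rewrite subrK powRr1 ?(ltW A0) // mulrC divfK // gt_eqF.
Qed.

End Pnorm.

(** * The functions phi, psi and mu *)

Section RealFunctions.
Variables (R : realType) (n : nat) (a b : R).
Hypotheses (a1 : 1 <= a) (b1 : 1 <= b).
Implicit Types x y s : R.

(** The factor common to [phi] and [psi * phi] once [x ^+ 2] is removed:
    [phi] is [x ^+ 2 * growth x / (1 - (a + b) * x)], and multiplying by [psi]
    only turns the last denominator into [1 - a * x]. *)
Definition growth x : R := a / (1 - (a + 1) * x) *
  (1 + (n.-1%:R)^-1 * (a * x / (1 - (a + b) * x))) ^+ n.-1.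

Let a0 : 0 <= a. Proof. exact: le_trans a1. Qed.

Lemma subr_ab_gt0 x : 0 <= x -> (a + b) * x < 1 ->
  [/\ 0 < 1 - (a + b) * x, 0 < 1 - (a + 1) * x & 0 < 1 - a * x].
Proof.
move=> x0 abx; have bx : x <= b * x by rewrite ler_peMl.
by move: abx; rewrite !mulrDl mul1r => abx; split; lra.
Qed.

Lemma phi_growth x : phi n a b x = x ^+ 2 * (growth x / (1 - (a + b) * x)).
Proof. by rewrite /phi /growth invfM; set N := _ ^+ n.-1; ring. Qed.

Lemma psi_phi_growth x : 0 <= x -> (a + b) * x < 1 ->
  psi a b x * phi n a b x = x ^+ 2 * (growth x / (1 - a * x)).
Proof.
move=> x0 abx; have [h1 h2 h3] := subr_ab_gt0 x0 abx.
by rewrite phi_growth /psi /growth; set N := _ ^+ n.-1; field; rewrite !gt_eqF.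
Qed.

Lemma growth_ge0 x : 0 <= x -> (a + b) * x < 1 -> 0 <= growth x.
Proof.
move=> x0 abx; have [h1 h2 h3] := subr_ab_gt0 x0 abx.
apply: mulr_ge0; first by rewrite divr_ge0 // ltW.
apply/exprn_ge0/addr_ge0 => //; apply: mulr_ge0;
  first by rewrite invr_ge0 ler0n.
by apply: divr_ge0; [apply: mulr_ge0 | exact: ltW].
Qed.

Section Monotonicity.
Variables (x y : R).
Hypotheses (y0 : 0 <= y) (yx : y <= x) (abx : (a + b) * x < 1).

Let x0 : 0 <= x. Proof. exact: le_trans yx. Qed.

Lemma aby_lt1 : (a + b) * y < 1.
Proof.
apply: le_lt_trans abx; rewrite ler_wpM2l // addr_ge0 //; exact: le_trans b1.
Qed.

Let le_inv c : 0 <= c -> 0 < 1 - c * x -> (1 - c * y)^-1 <= (1 - c * x)^-1.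
Proof.
move=> c0 cx; have cyx : c * y <= c * x by rewrite ler_wpM2l.
by rewrite lef_pV2 ?posrE //; lra.
Qed.

Lemma mu_le : mu a y <= mu a x.
Proof. by have [_ _ h3] := subr_ab_gt0 x0 abx; exact: le_inv. Qed.

Lemma growth_le : growth y <= growth x.
Proof.
have [h1 h2 h3] := subr_ab_gt0 x0 abx.
have [k1 k2 k3] := subr_ab_gt0 y0 aby_lt1.
have b0 : 0 <= b by exact: le_trans b1.
have H1 : (1 - (a + 1) * y)^-1 <= (1 - (a + 1) * x)^-1.
  by rewrite le_inv // addr_ge0.
have H2 : (1 - (a + b) * y)^-1 <= (1 - (a + b) * x)^-1.
  by rewrite le_inv // addr_ge0.
have n0 : 0 <= n.-1%:R^-1 :> R by rewrite invr_ge0 ler0n.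
have T0 w : 0 <= w -> 0 < 1 - (a + b) * w ->
    0 <= 1 + n.-1%:R^-1 * (a * w / (1 - (a + b) * w)).
  move=> w0 w1; apply: addr_ge0 => //; apply: mulr_ge0 => //.
  by apply: divr_ge0; [exact: mulr_ge0 | exact: ltW].
apply: ler_pM.
- by apply: divr_ge0 => //; exact: ltW.
- exact/exprn_ge0/T0.
- exact: ler_wpM2l.
- rewrite lerXn2r ?nnegrE ?T0 // lerD2l; apply: ler_wpM2l => //.
  apply: ler_pM => //; first exact: mulr_ge0.
    by rewrite invr_ge0 ltW.
  exact: ler_wpM2l.
Qed.

Variable s : R.
Hypothesis ysx : y <= s * x.

Let sq : y ^+ 2 <= s ^+ 2 * x ^+ 2.
Proof. by rewrite -exprMn lerXn2r ?nnegrE // (le_trans y0). Qed.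

(** A quadratic factor times an increasing one: shrinking the argument by [s]
    shrinks the value by [s ^+ 2]. Together with [E (F z) <= phi (E z) * E z]
    this is what makes the exponents [3 ^ k] appear. *)
Lemma phi_scale : phi n a b y <= s ^+ 2 * phi n a b x.
Proof.
rewrite !phi_growth [leRHS]mulrA.
have [k1 _ _] := subr_ab_gt0 y0 aby_lt1.
have [h1 _ _] := subr_ab_gt0 x0 abx.
apply: ler_pM => //; first exact: exprn_ge0.
  by rewrite divr_ge0 ?growth_ge0 ?aby_lt1 // ltW.
apply: ler_pM; rewrite ?growth_ge0 ?aby_lt1 ?growth_le ?invr_ge0 ?(ltW k1) //.
by apply: le_inv => //; rewrite addr_ge0 // (le_trans _ b1).
Qed.

(** Although [psi] is decreasing, its numerator cancels a denominator of [phi],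
    so that the product keeps a quadratic upper bound with a constant taken at
    the larger argument. *)
Lemma psi_phi_le_sq :
  psi a b y * phi n a b y <= y ^+ 2 * (growth x / (1 - a * x)).
Proof.
rewrite psi_phi_growth ?aby_lt1 //.
have [_ _ k3] := subr_ab_gt0 y0 aby_lt1.
have [_ _ h3] := subr_ab_gt0 x0 abx.
apply: ler_wpM2l; first exact: exprn_ge0.
by apply: ler_pM; rewrite ?growth_ge0 ?aby_lt1 ?growth_le ?invr_ge0 ?(ltW k3)
  ?le_inv.
Qed.

Lemma psi_phi_scale :
  psi a b y * phi n a b y <= s ^+ 2 * (psi a b x * phi n a b x).
Proof.
apply: le_trans psi_phi_le_sq _; rewrite psi_phi_growth // [leRHS]mulrA.
have [_ _ h3] := subr_ab_gt0 x0 abx.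
by apply: ler_wpM2r sq; rewrite divr_ge0 ?growth_ge0 // ltW.
Qed.

End Monotonicity.

Lemma psi_bounds x : 0 <= x -> (a + b) * x < 1 -> 0 < psi a b x <= 1.
Proof.
move=> x0 abx; have [h1 h2 h3] := subr_ab_gt0 x0 abx.
rewrite divr_gt0 //= ler_pdivrMr // mul1r mulrDl.
have : 0 <= b * x by rewrite mulr_ge0 // (le_trans _ b1).
lra.
Qed.

Lemma phi_nonneg x : 0 <= x -> (a + b) * x < 1 -> 0 <= phi n a b x.
Proof.
move=> x0 abx; have [h1 _ _] := subr_ab_gt0 x0 abx.
by rewrite phi_growth mulr_ge0 ?exprn_ge0 // divr_ge0 ?growth_ge0 // ltW.
Qed.

(** For positive [x] the strictness comes from [psi x < 1]; at [x = 0], where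
    [psi] is [1], it comes from [phi 0 = 0]. *)
Lemma psi_phi_lt1 x : 0 <= x -> (a + b) * x < 1 -> phi n a b x <= 1 ->
  psi a b x * phi n a b x < 1.
Proof.
move=> x0 abx phix; have /andP[p0 p1] := psi_bounds x0 abx.
have [xe|xn] := eqVneq x 0; first by rewrite psi_phi_growth // xe expr0n mul0r.
apply: le_lt_trans (_ : psi a b x * 1 < 1); first by rewrite ler_wpM2l // ltW.
have [h1 h2 h3] := subr_ab_gt0 x0 abx.
rewrite mulr1 ltr_pdivrMr // mul1r mulrDl.
have : 0 < b * x.
  by apply: mulr_gt0; [exact: lt_le_trans b1 | rewrite lt_def xn].
lra.
Qed.

(** The a posteriori bound moves two components together by at most this
    fraction of their distance; hence the components of the limit stay apart. *)
Lemma error_factor_lt1 x : 0 <= x -> (a + b) * x < 1 -> phi n a b x < 1 ->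
  mu a x / (1 - psi a b x * phi n a b x) * (b * x) < 1.
Proof.
move=> x0 abx phix; have [h1 h2 h3] := subr_ab_gt0 x0 abx.
have := psi_phi_lt1 x0 abx (ltW phix); rewrite -subr_gt0 => h4.
rewrite /mu -invfM mulrC ltr_pdivrMr ?mulr_gt0 // mul1r /psi.
have -> : (1 - a * x) * (1 - (1 - (a + b) * x) / (1 - a * x) * phi n a b x) =
    b * x + (1 - (a + b) * x) * (1 - phi n a b x).
  by field; rewrite gt_eqF.
by rewrite ltrDl mulr_gt0 // subr_gt0.
Qed.

End RealFunctions.

(** * Lagrange expansion at the nodes *)

Section WeierstrassAlgebra.
Variables (K : fieldType) (n : nat) (f : {poly K}) (z : 'I_n -> K).
Hypotheses (fmonic : f \is monic) (fsize : size f = n.+1) (zinj : injective z).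

Let P i := \prod_(j < n | j != i) (z i - z j).
Let w i := f.[z i] / P i.

Let subz_neq0 i j : j != i -> z i - z j != 0.
Proof. by move=> ji; rewrite subr_eq0 (inj_eq zinj) eq_sym. Qed.

Let P_neq0 i : P i != 0.
Proof. by apply/prodf_neq0 => j; exact: subz_neq0. Qed.

(** Lagrange interpolation: the difference of the two sides has degree below [n]
    (the leading terms cancel) and vanishes at the [n] nodes. *)
Lemma weierstrass_expansion : f = \prod_(j < n) ('X - (z j)%:P) +
  \sum_(k < n) w k *: \prod_(j < n | j != k) ('X - (z j)%:P).
Proof.
set Q := \prod_(j < n) _; set S := \sum_(k < n) _.
have Qmonic : Q \is monic by apply: monic_prod => j _; exact: monicXsubC.
have Qsize : size Q = n.+1.
  by rewrite /Q size_prod_XsubC /index_enum -enumT size_enum_ord.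
have Ssize : (size S <= n)%N.
  apply: (big_ind (fun p : {poly K} => size p <= n)%N).
  - by rewrite size_poly0.
  - by move=> p1 p2 h1 h2; apply: leq_trans (size_polyD _ _) _;
      rewrite geq_max h1.
  - move=> k _; apply: leq_trans (size_scale_leq _ _) _.
    rewrite -big_filter size_prod_XsubC size_filter -sum1_count.
    by rewrite sum1_card cardC1 card_ord (ltn_predK (ltn_ord k)).
have fQsize : (size (f - Q)%R <= n)%N.
  apply/leq_sizeP => j; rewrite leq_eqVlt => /predU1P[<-|nj].
    have := monicP fmonic; have := monicP Qmonic.
    by rewrite !lead_coefE fsize Qsize /= coefB => -> ->; rewrite subrr.
  by rewrite coefB !nth_default ?subr0 ?fsize ?Qsize.
apply/eqP; rewrite addrC -subr_eq -subr_eq0; apply/eqP.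
apply: (@roots_geq_poly_eq0 _ _ (codom z)).
- apply/allP => _ /codomP[i ->]; apply/rootP; rewrite !(hornerD, hornerN).
  rewrite horner_prod (bigD1 i) //= hornerXsubC subrr mul0r subr0.
  suff -> : S.[z i] = f.[z i] by rewrite subrr.
  have SiP k : (\prod_(j < n | j != k) ('X - (z j)%:P)).[z i] =
      if k == i then P i else 0.
    rewrite horner_prod; have [->|ki] := eqVneq k i.
      by apply: eq_bigr => j _; rewrite hornerXsubC.
    by rewrite (bigD1 i) 1?eq_sym //= hornerXsubC subrr mul0r.
  rewrite horner_sum (bigD1 i) //= hornerZ SiP eqxx divfK ?P_neq0 //.
  rewrite big1 ?addr0 // => k ki.
  by rewrite hornerZ SiP (negPf ki) mulr0.
- by rewrite map_inj_uniq // enum_uniq.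
- rewrite size_codom card_ord; apply: leq_trans (size_polyD _ _) _.
  by rewrite size_polyN geq_max Ssize fQsize.
Qed.

Lemma horner_weierstrass_expansion x : f.[x] = \prod_(j < n) (x - z j) +
  \sum_(k < n) w k * \prod_(j < n | j != k) (x - z j).
Proof.
rewrite {1}weierstrass_expansion hornerD horner_prod horner_sum; congr (_ + _).
  by apply: eq_bigr => j _; rewrite hornerXsubC.
apply: eq_bigr => k _; rewrite hornerZ horner_prod; congr (_ * _).
by apply: eq_bigr => j _; rewrite hornerXsubC.
Qed.

Let horner_deriv_XsubCM (c : K) (p : {poly K}) :
  (('X - c%:P) * p)^`().[c] = p.[c].
Proof. by rewrite derivM derivXsubC !hornerE subrr mul0r addr0. Qed.

Lemma horner_deriv_prod_XsubC (I : Type) (r : seq I) (A : pred I)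
    (c : I -> K) x :
  (forall i, A i -> x - c i != 0) ->
  (\prod_(i <- r | A i) ('X - (c i)%:P))^`().[x] =
  \prod_(i <- r | A i) (x - c i) * \sum_(i <- r | A i) (x - c i)^-1.
Proof.
move=> xc; suff [] : (\prod_(i <- r | A i) ('X - (c i)%:P)).[x] =
    \prod_(i <- r | A i) (x - c i) /\
  (\prod_(i <- r | A i) ('X - (c i)%:P))^`().[x] =
    \prod_(i <- r | A i) (x - c i) * \sum_(i <- r | A i) (x - c i)^-1 by [].
elim/big_rec3: _ => [|i s p1 p2 Ai [h1 h2]].
  by rewrite derivC !hornerC mulr0.
rewrite derivM derivXsubC !hornerE h1 h2; split=> //.
by field; exact: xc.
Qed.

(** Werner's form of the denominator, obtained by differentiating the Lagrange
    expansion at a node. *)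
Lemma ehrlich_denomE i :
  f^`().[z i] - f.[z i] * \sum_(j < n | j != i) (z i - z j)^-1 =
  P i * (1 + \sum_(j < n | j != i) w j / (z i - z j)).
Proof.
have fP : f.[z i] = w i * P i by rewrite divfK ?P_neq0.
have -> : f^`().[z i] =
    (P i + w i * (P i * \sum_(j < n | j != i) (z i - z j)^-1)) +
    P i * \sum_(j < n | j != i) w j / (z i - z j).
  have hP (A : pred 'I_n) : (\prod_(j < n | A j) ('X - (z j)%:P)).[z i] =
      \prod_(j < n | A j) (z i - z j).
    by rewrite horner_prod; apply: eq_bigr => j _; rewrite hornerXsubC.
  rewrite {1}weierstrass_expansion derivD hornerD (bigD1 i) //=.
  rewrite horner_deriv_XsubCM hP -addrA; congr (_ + _).
  rewrite raddf_sum horner_sum (bigD1 i) //= derivZ hornerZ.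
  rewrite horner_deriv_prod_XsubC; last by move=> j; exact: subz_neq0.
  congr (_ + _); rewrite mulr_sumr; apply: eq_bigr => k ki.
  rewrite derivZ hornerZ (bigD1 i) 1?eq_sym //= horner_deriv_XsubCM hP.
  rewrite /P [in RHS](bigD1 k) //=.
  under [in RHS]eq_bigl => j do rewrite andbC.
  by field; exact: subz_neq0.
by rewrite fP; ring.
Qed.

(** The source of cubic convergence. The expansion at [x] contains the bracket
    [(x - z i) * (1 + sum w k / (x - z k)) + w i]; the equation defining the
    Ehrlich step says that this bracket vanishes once each [x - z k] is replaced
    by [z i - z k], so that what is left carries two factors [x - z i] and one
    factor [w k]. *)
Lemma horner_ehrlich_step i x : (forall j, j != i -> x - z j != 0) ->
  (x - z i) * (1 + \sum_(k < n | k != i) w k / (z i - z k)) = - w i ->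
  f.[x] = - (x - z i) ^+ 2 *
    (\sum_(k < n | k != i) w k / ((x - z k) * (z i - z k))) *
    \prod_(j < n | j != i) (x - z j).
Proof.
move=> xz xstep; rewrite horner_weierstrass_expansion.
rewrite (bigD1 i) //= [X in _ + X](bigD1 i) //=.
set L := \prod_(j < n | j != i) _.
have -> : \sum_(k < n | k != i) w k * \prod_(j < n | j != k) (x - z j) =
    (x - z i) * (\sum_(k < n | k != i) w k / (x - z k)) * L.
  rewrite mulr_sumr mulr_suml; apply: eq_bigr => k ki.
  rewrite (bigD1 i) 1?eq_sym //= /L [in RHS](bigD1 k ki) /=.
  have -> : \prod_(j < n | (j != k) && (j != i)) (x - z j) =
     \prod_(j < n | (j != i) && (j != k)) (x - z j).
    by apply: eq_bigl => j; rewrite andbC.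
  by field; exact: xz.
have : (\sum_(k < n | k != i) w k / ((x - z k) * (z i - z k))) * (x - z i) =
   \sum_(k < n | k != i) w k / (z i - z k) -
   \sum_(k < n | k != i) w k / (x - z k).
  rewrite mulr_suml -sumrB; apply: eq_bigr => k ki.
  by field; rewrite xz // subz_neq0.
move=> S12; have := xstep.
move: S12; set S1 := \sum_(k < n | k != i) w k / (z i - z k).
set S2 := \sum_(k < n | k != i) w k / (x - z k); set T := \sum_(k < n | _) _.
move=> S12 wi; have -> : w i = - ((x - z i) * (1 + S1)) by rewrite wi opprK.
have -> : S1 = T * (x - z i) + S2 by rewrite S12 subrK.
by ring.
Qed.

End WeierstrassAlgebra.

(** * Separation of the components *)

Section Separation.
Variables (R : realType) (n : nat).
Implicit Types z : 'rV[R[i]]_n.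

Lemma sep_le z i j : j != i -> sep z i <= cabs (z 0 i - z 0 j).
Proof.
move=> ji; apply: ge_inf; last by exists j.
by exists 0 => _ [k _ <-]; exact: cabs_ge0.
Qed.

Hypothesis n2 : (2 <= n)%N.

Lemma exists_other (i : 'I_n) : exists j : 'I_n, j != i.
Proof.
have : (0 < #|predC1 i|)%N by rewrite cardC1 card_ord -ltnS prednK // ltnW.
by move=> /card_gt0P[j]; exists j.
Qed.

Lemma le_sep z i (c : R) :
  (forall j, j != i -> c <= cabs (z 0 i - z 0 j)) -> c <= sep z i.
Proof.
move=> cz; apply: lb_le_inf => [|_ [j ji <-]]; last exact: cz.
by have [j ji] := exists_other i; exists (cabs (z 0 i - z 0 j)), j.
Qed.

Lemma sep_gt0 z i : distinct_components z -> 0 < sep z i.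
Proof.
move=> zinj; have [j0 j0i] := exists_other i.
have [j ji jmin] := @Order.TotalTheory.arg_minP _ R _ j0 (predC1 i)
  (fun j => cabs (z 0 i - z 0 j)) j0i.
apply: (@lt_le_trans _ _ (cabs (z 0 i - z 0 j))); last exact: le_sep.
by rewrite cabs_gt0 subr_eq0 (inj_eq zinj) eq_sym.
Qed.

End Separation.

(** * One step of the iteration *)

Section Step.
Variables (R : realType) (n : nat) (f : {poly R[i]}) (p q : \bar R).
Hypotheses (n2 : (2 <= n)%N) (fmonic : f \is monic) (fsize : size f = n.+1).
Hypotheses (p1 : (1 <= p)%E) (pq : (p^-1 + q^-1 = 1)%E).
Let a : R := n.-1%:R `^ fine (q^-1)%E.
Let b : R := 2 `^ fine (q^-1)%E.

Lemma ge1_a : 1 <= a.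
Proof.
rewrite -[leLHS](powRr0 n.-1%:R) /a ler_powR ?(conj_exp_ge0 p1 pq) //.
by rewrite ler1n -ltnS prednK // ltnW.
Qed.

Lemma ge1_b : 1 <= b.
Proof.
by rewrite -[leLHS](powRr0 2) /b ler_powR ?(conj_exp_ge0 p1 pq) // ler1n.
Qed.

Variable z : 'rV[R[i]]_n.
Hypothesis zinj : distinct_components z.

Let W i := weierstrass f z 0 i.
Let x := Efun f p z.
Let h i := cabs (W i) / sep z i.

Let h_ge0 i : 0 <= h i.
Proof. by rewrite divr_ge0 ?cabs_ge0 // ltW // sep_gt0. Qed.

Let cabs_ratio i :
  cabs ((\row_i (weierstrass f z 0 i / (sep z i)%:C) : 'rV[R[i]]_n) 0 i) = h i.
Proof.
by rewrite mxE cabsM cabsV cabs_real // ltW // sep_gt0.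
Qed.

Let x_ge0 : 0 <= x. Proof. exact: pnorm_ge0 p1 pq _ _. Qed.

Let h_le i : h i <= x.
Proof. by rewrite -cabs_ratio; exact: le_cabs_pnorm p1 pq _ _ _. Qed.

Let sum_h i : \sum_(j < n | j != i) h j <= a * x.
Proof.
under eq_bigr => j _ do rewrite -cabs_ratio.
apply: le_trans (sum_cabs_le_pnorm p1 pq (predC1 i) _) _.
by rewrite cardC1 card_ord.
Qed.

Let pair_h i j : j != i -> h i + h j <= b * x.
Proof.
move=> ji; have := sum_cabs_le_pnorm p1 pq (pred2 i j)
  (\row_i (weierstrass f z 0 i / (sep z i)%:C)).
under eq_bigr => k _ do rewrite cabs_ratio.
rewrite card2 eq_sym ji (bigD1 i) ?inE ?eqxx //= (big_pred1 j) // => k.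
by rewrite !inE; case: eqVneq => [->|]; rewrite ?andbT //= eq_sym (negPf ji).
Qed.

Let cabs_W_le i j : j != i -> cabs (W i) <= h i * cabs (z 0 i - z 0 j).
Proof.
move=> ji; rewrite -[leLHS](divfK (_ : sep z i != 0)); last first.
  by rewrite gt_eqF // sep_gt0.
by rewrite ler_wpM2l ?h_ge0 // sep_le.
Qed.

Lemma weierstrass_le_Efun i j : j != i ->
  cabs (weierstrass f z 0 i) <= Efun f p z * cabs (z 0 i - z 0 j).
Proof.
by move=> ji; apply: le_trans (cabs_W_le ji) _; rewrite ler_wpM2r ?cabs_ge0.
Qed.

Lemma weierstrass_pair_le_Efun i j : j != i ->
  cabs (weierstrass f z 0 i) + cabs (weierstrass f z 0 j) <=
  b * Efun f p z * cabs (z 0 i - z 0 j).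
Proof.
move=> ji; have ij : i != j by rewrite eq_sym.
apply: le_trans (lerD (cabs_W_le ji) (cabs_W_le ij)) _.
by rewrite (cabs_distC (z 0 j)) -mulrDl ler_wpM2r ?cabs_ge0 // pair_h.
Qed.

Lemma Efun_le_pnorm_weierstrass (C : R) : 0 <= C ->
  (forall i, (sep z i)^-1 <= C) -> Efun f p z <= C * pnorm p (weierstrass f z).
Proof.
move=> C0 sC; apply: (pnorm_le p1 pq) => // i.
by rewrite cabs_ratio /h [leLHS]mulrC ler_wpM2r ?cabs_ge0.
Qed.

Let subz_gt0 i j : j != i -> 0 < cabs (z 0 i - z 0 j).
Proof. by move=> ji; rewrite cabs_gt0 subr_eq0 (inj_eq zinj) eq_sym. Qed.

Hypothesis x_small : (a + b) * x < 1.

Let ax1 : 0 < 1 - a * x.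
Proof. by have [] := subr_ab_gt0 ge1_b x_ge0 x_small. Qed.

Let a1x1 : 0 < 1 - (a + 1) * x.
Proof. by have [] := subr_ab_gt0 ge1_b x_ge0 x_small. Qed.

Let s i := 1 + \sum_(k < n | k != i) W k / (z 0 i - z 0 k).

(** Triangle inequality around [1]: the sum has modulus at most [a * x]. *)
Let s_ge i : 1 - a * x <= cabs (s i).
Proof.
rewrite lerBlDr -[leLHS](cabs1 R) -[X in cabs X](addrK
  (\sum_(k < n | k != i) W k / (z 0 i - z 0 k))) -/(s i).
apply: le_trans (cabsD _ _) _; rewrite lerD2l cabsN.
apply: le_trans (cabs_sum _ _ _) _; apply: le_trans (sum_h i).
apply: ler_sum => k ki; rewrite cabsM cabsV ler_pdivrMr ?subz_gt0 //.
by rewrite cabs_distC cabs_W_le // eq_sym.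
Qed.

Let s_neq0 i : s i != 0.
Proof. by rewrite -cabs_gt0 (lt_le_trans ax1) // s_ge. Qed.

Let Pz i := \prod_(j < n | j != i) (z 0 i - z 0 j).

Let Pz_neq0 i : Pz i != 0.
Proof. by apply/prodf_neq0 => j ji; rewrite -cabs_gt0 subz_gt0. Qed.

Let WE i : W i = f.[z 0 i] / Pz i. Proof. by rewrite /W mxE. Qed.

Let denomE i : ehrlich_denom f z i = Pz i * s i.
Proof.
rewrite /ehrlich_denom (ehrlich_denomE fmonic fsize zinj) /s;
  congr (_ * (_ + _)).
by apply: eq_bigr => k _; rewrite WE.
Qed.

Lemma ehrlich_definedP : ehrlich_defined f z.
Proof. by split=> // i; rewrite denomE mulf_neq0. Qed.

Let y i := ehrlich f z 0 i.

Let y_sub i : (y i - z 0 i) * s i = - W i.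
Proof.
rewrite /y mxE denomE WE; field.
by rewrite s_neq0 Pz_neq0.
Qed.

Lemma ehrlich_displacement i :
  cabs (ehrlich f z 0 i - z 0 i) <= mu a x * cabs (weierstrass f z 0 i).
Proof.
rewrite mulrC /mu ler_pdivlMr // -(cabsN (weierstrass f z 0 i)) -y_sub cabsM.
by rewrite ler_wpM2l ?cabs_ge0 // s_ge.
Qed.

Let y_sub_le i j : j != i ->
  cabs (y i - z 0 i) <= mu a x * h i * cabs (z 0 i - z 0 j).
Proof.
move=> ji; apply: le_trans (ehrlich_displacement i) _.
by rewrite -mulrA ler_wpM2l ?cabs_W_le // invr_ge0 ltW.
Qed.

Let psi_gt0 : 0 < psi a b x.
Proof. by rewrite divr_gt0 // subr_gt0. Qed.

(** Each component moves by a fraction [mu * h i] of its distance to any other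
    one, and [h i + h j <= b * x]; what is left of the distance is
    [1 - mu * b * x], that is [psi x]. *)
Lemma ehrlich_separation i j : j != i -> psi a b x * cabs (z 0 i - z 0 j) <=
  cabs (ehrlich f z 0 i - ehrlich f z 0 j).
Proof.
move=> ji; have ij : i != j by rewrite eq_sym.
have Hi := y_sub_le ji; have := y_sub_le ij; rewrite (cabs_distC (z 0 j)) => Hj.
have T1 := cabs_tri (z 0 i) (y i) (z 0 j).
have T2 := cabs_tri (y i) (y j) (z 0 j).
rewrite (cabs_distC (z 0 i) (y i)) in T1.
have -> : psi a b x = 1 - mu a x * (b * x).
  by rewrite /psi /mu; field; rewrite gt_eqF.
have m0 : 0 <= mu a x by rewrite invr_ge0 ltW.
have : mu a x * (h i + h j) * cabs (z 0 i - z 0 j) <=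
       mu a x * (b * x) * cabs (z 0 i - z 0 j).
  by rewrite ler_wpM2r ?cabs_ge0 // ler_wpM2l // pair_h.
rewrite -/(y i) -/(y j); lra.
Qed.

Lemma ehrlich_distinct : distinct_components (ehrlich f z).
Proof.
move=> i j yij; apply/eqP; rewrite eq_sym; apply: contraT => ji.
have := ehrlich_separation ji; rewrite yij subrr cabs0 leNgt.
by rewrite mulr_gt0 // subz_gt0.
Qed.

Let y_subz_ge i j : j != i ->
  (1 - mu a x * x) * cabs (z 0 i - z 0 j) <= cabs (y i - z 0 j).
Proof.
move=> ji; have H := y_sub_le ji; have T := cabs_tri (z 0 i) (y i) (z 0 j).
rewrite (cabs_distC (z 0 i) (y i)) in T.
have m0 : 0 <= mu a x by rewrite invr_ge0 ltW.
have : mu a x * h i * cabs (z 0 i - z 0 j) <= mu a x * x * cabs (z 0 i - z 0 j).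
  by rewrite ler_wpM2r ?cabs_ge0 // ler_wpM2l.
lra.
Qed.

Let mx1 : 1 - mu a x * x = (1 - (a + 1) * x) / (1 - a * x).
Proof. by rewrite /mu; field; rewrite gt_eqF. Qed.

Let y_subz_gt0 i j : j != i -> 0 < cabs (y i - z 0 j).
Proof.
move=> ji; apply: lt_le_trans (y_subz_ge ji).
by rewrite mx1 mulr_gt0 ?divr_gt0 ?subz_gt0.
Qed.

Let suby_gt0 i j : j != i -> 0 < cabs (y i - y j).
Proof.
by move=> ji; apply: lt_le_trans (ehrlich_separation ji);
  rewrite mulr_gt0 ?subz_gt0.
Qed.

(** In the formula of [horner_ehrlich_step], one of the two displacements is
    bounded by [mu * |W i|], the other one together with the sum by
    [x / (1 - (a + 1) * x) * (a * x)], and the quotient of products by the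
    inequality of arithmetic and geometric means. *)
Lemma ehrlich_weierstrass i : cabs (weierstrass f (ehrlich f z) 0 i) <=
  psi a b x * phi n a b x * cabs (weierstrass f z 0 i).
Proof.
set T := \sum_(k < n | k != i) W k / ((y i - z 0 k) * (z 0 i - z 0 k)).
have WyE : weierstrass f (ehrlich f z) 0 i = - (y i - z 0 i) ^+ 2 * T *
    \prod_(j < n | j != i) ((y i - z 0 j) / (y i - y j)).
  rewrite mxE -/(y i) big_split /= -prodfV.
  rewrite (horner_ehrlich_step fmonic fsize zinj (i := i)).
  - rewrite mulrA; congr (_ * _ * _ * _).
    by apply: eq_bigr => k _; rewrite WE.
  - by move=> j ji; rewrite -cabs_gt0 y_subz_gt0.
  - rewrite -[X in _ = - X]WE -y_sub; congr (_ * (_ + _)).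
    by apply: eq_bigr => k _; rewrite WE.
rewrite WyE expr2 -mulNr !cabsM cabsN.
have -> : psi a b x * phi n a b x * cabs (weierstrass f z 0 i) =
    mu a x * cabs (weierstrass f z 0 i) *
    (x / (1 - (a + 1) * x) * (a * x)) *
    (1 + (n.-1%:R)^-1 * (a * x / (1 - (a + b) * x))) ^+ n.-1.
  rewrite /psi /phi /mu; set N := (_ ^+ n.-1); field.
  by rewrite !gt_eqF // subr_gt0.
rewrite -(mulrA (cabs _) (cabs _) (cabs T)).
apply: ler_pM; rewrite ?mulr_ge0 ?cabs_ge0 //; first apply: ler_pM;
  rewrite ?mulr_ge0 ?cabs_ge0 ?ehrlich_displacement //.
- rewrite -cabsM mulr_sumr; apply: le_trans (cabs_sum _ _ _) _.
  apply: le_trans (ler_wpM2l _ (sum_h i)); last by rewrite divr_ge0 // ltW.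
  rewrite mulr_sumr; apply: ler_sum => k ki.
  rewrite !cabsM cabsV cabsM invfM [leLHS]mulrA [leLHS]mulrACA.
  apply: ler_pM; rewrite ?mulr_ge0 ?invr_ge0 ?cabs_ge0 //; last first.
    rewrite ler_pdivrMr ?subz_gt0 // cabs_distC cabs_W_le //.
    by rewrite eq_sym.
  rewrite ler_pdivrMr ?y_subz_gt0 //.
  apply: le_trans (_ : mu a x * x * cabs (z 0 i - z 0 k) <= _).
    apply: le_trans (y_sub_le ki) _.
    rewrite ler_wpM2r ?cabs_ge0 // ler_wpM2l //.
    by rewrite invr_ge0 ltW.
  have -> : mu a x * x * cabs (z 0 i - z 0 k) = x / (1 - (a + 1) * x) *
      ((1 - mu a x * x) * cabs (z 0 i - z 0 k)).
    by rewrite mx1 /mu; field; rewrite !gt_eqF.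
  by rewrite ler_wpM2l ?y_subz_ge // divr_ge0 // ltW.
have ab0 : 0 < 1 - (a + b) * x by rewrite subr_gt0.
pose c := (1 - (a + b) * x)^-1.
have c0 : 0 <= c by rewrite invr_ge0 ltW.
rewrite cabs_prod.
apply: (@le_trans _ _ (\prod_(j in predC1 i) (1 + c * h j))).
  apply: ler_prod => j ji.
  rewrite cabs_ge0 cabsM cabsV ler_pdivrMr ?suby_gt0 //.
  apply: le_trans (cabs_tri _ (y j) _) _; rewrite mulrDl mul1r lerD2l.
  have ij : i != j by rewrite eq_sym.
  apply: le_trans (y_sub_le ij) _.
  have -> : mu a x * h j * cabs (z 0 j - z 0 i) =
      c * h j * (psi a b x * cabs (z 0 i - z 0 j)).
    by rewrite (cabs_distC (z 0 j)) /mu /c /psi; field; rewrite !gt_eqF.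
  by rewrite ler_wpM2l ?ehrlich_separation // mulr_ge0.
have ch0 j : 0 <= 1 + c * h j by rewrite addr_ge0 // mulr_ge0.
have n1 : 0 < n.-1%:R :> R by rewrite ltr0n -ltnS prednK // ltnW.
(* Arithmetic and geometric means of the n - 1 factors. *)
have := @leif_AGM R _ (predC1 i) (fun j => 1 + c * h j) (fun j _ => ch0 j).
rewrite cardC1 card_ord => -[H _]; apply: le_trans H _.
rewrite lerXn2r ?nnegrE //.
- by rewrite divr_ge0 ?ler0n // sumr_ge0.
- apply: addr_ge0 => //; apply: mulr_ge0; first by rewrite invr_ge0 ler0n.
  by rewrite divr_ge0 ?mulr_ge0 ?(ltW ab0) // (le_trans ler01 ge1_a).
rewrite ler_pdivrMr // big_split /= sumr_const cardC1 card_ord.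
rewrite mulrDl mul1r lerD2l.
rewrite mulrAC mulVf ?gt_eqF // mul1r -mulr_sumr [leRHS]mulrC -/c.
by rewrite ler_wpM2l // sum_h.
Qed.

(** The loss [psi] in the separation of the components cancels the factor [psi]
    gained in the corrections. *)
Lemma ehrlich_Efun : Efun f p (ehrlich f z) <= phi n a b x * x.
Proof.
apply: (pnorm_le p1 pq) => [|i].
  exact: (phi_nonneg n ge1_a ge1_b x_ge0 x_small).
have S0 := sep_gt0 n2 i zinj; have S1 := sep_gt0 n2 i ehrlich_distinct.
rewrite cabs_ratio mxE cabsM cabsV cabs_real ?(ltW S1) // ler_pdivrMr //.
apply: le_trans (ehrlich_weierstrass i) _.
have -> : psi a b x * phi n a b x * cabs (weierstrass f z 0 i) =
    phi n a b x * h i * (psi a b x * sep z i).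
  by rewrite /h /W; field; rewrite gt_eqF.
apply: ler_wpM2l; first by rewrite mulr_ge0 // (phi_nonneg n ge1_a ge1_b).
apply: le_sep => // j ji; apply: le_trans (ehrlich_separation ji).
by rewrite ler_wpM2l ?sep_le // ltW.
Qed.

End Step.

(** * Complex sequences with geometric increments *)

Section ComplexSequences.
Variable R : realType.

(** Lets the estimates live in [R], while limits of sums and products are taken
    in the normed field of complex numbers. *)
Lemma cvg_cabsP (u : nat -> R[i]) (l : R[i]) :
  cabs (u k - l) @[k --> \oo] --> (0 : R) <->
  (u : nat -> R[i]^o) @ \oo --> (l : R[i]^o).
Proof.
split=> [H|H].
  apply/(@cvgrPdist_le R[i] R[i]^o) => e e0.
  have eE : (complex.Re e)%:C = e by apply: RRe_real; rewrite gtr0_real.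
  have e1 : 0 < complex.Re e by rewrite -ltcR eE.
  move/cvgr0Pnorm_le: H => /(_ _ e1); apply: filterS => k.
  by rewrite ger0_norm ?cabs_ge0 // cabsE lecE -eE /= eqxx -cabs_distC.
apply/cvgr0Pnorm_le => e e0.
have e1 : 0 < e%:C by rewrite ltcR.
move/(@cvgrPdist_le R[i] R[i]^o): H => /(_ _ e1); apply: filterS => k.
by rewrite cabsE lecR ger0_norm ?cabs_ge0 // cabs_distC.
Qed.

Lemma cvg_geometric_increments (v : nat -> R) (M rho : R) :
  0 <= rho -> rho < 1 ->
  (forall k, `|v k.+1 - v k| <= M * rho ^+ k) -> cvgn v.
Proof.
move=> r0 r1 H.
have M0 : 0 <= M by have := H 0%N; rewrite expr0 mulr1; exact: le_trans.
have : cvgn (series (telescope v)).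
  apply: normed_cvg; apply: (@series_le_cvg _ _ (geometric M rho)) => //.
  - by move=> k; exact: normr_ge0.
  - by move=> k; rewrite /= mulr_ge0 ?exprn_ge0.
  - by apply: is_cvg_geometric_series; rewrite ger0_norm.
rewrite telescopeK => H2.
have -> : v = (fun k => v k - v 0%N) \+ cst (v 0%N).
  by apply/funext => k /=; rewrite subrK.
by apply: is_cvgD => //; exact: is_cvg_cst.
Qed.

Lemma cabs_le_ReIm (x : R[i]) : cabs x <= `|complex.Re x| + `|complex.Im x|.
Proof.
case: x => c d /=; rewrite -[leRHS]ger0_norm ?addr_ge0 // -sqrtr_sqr.
apply: ler_wsqrtr; rewrite sqrrD !real_normK ?num_real //.
by rewrite addrAC lerDl mulrn_wge0 // mulr_ge0.
Qed.

Lemma ReIm_le_cabs (x : R[i]) :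
  `|complex.Re x| <= cabs x /\ `|complex.Im x| <= cabs x.
Proof.
case: x => c d /=.
by split; rewrite -sqrtr_sqr ler_wsqrtr // ?lerDl ?lerDr sqr_ge0.
Qed.

(** Completeness of the complex numbers, for the sequences needed here, reduced
    to the completeness of the reals through real and imaginary parts. *)
Lemma complex_geometric_cvg (u : nat -> R[i]) (M rho : R) :
  0 <= rho -> rho < 1 -> (forall k, cabs (u k.+1 - u k) <= M * rho ^+ k) ->
  exists l, cabs (u k - l) @[k --> \oo] --> (0 : R).
Proof.
move=> r0 r1 H.
have ReB (x y : R[i]) : complex.Re (x - y) = complex.Re x - complex.Re y.
  by case: x; case: y.
have ImB (x y : R[i]) : complex.Im (x - y) = complex.Im x - complex.Im y.
  by case: x; case: y.
have /cvg_ex[lr Hr] : cvgn (fun k => complex.Re (u k)).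
  apply: (cvg_geometric_increments r0 r1 (M := M)) => k.
  by rewrite -ReB; apply: le_trans (H k); case: (ReIm_le_cabs (u k.+1 - u k)).
have /cvg_ex[li Hi] : cvgn (fun k => complex.Im (u k)).
  apply: (cvg_geometric_increments r0 r1 (M := M)) => k.
  by rewrite -ImB; apply: le_trans (H k); case: (ReIm_le_cabs (u k.+1 - u k)).
exists (lr +i* li)%C.
apply: (@squeeze_cvgr _ _ _ _ (fun=> 0)
  (fun k => `|complex.Re (u k) - lr| + `|complex.Im (u k) - li|)).
- apply: nearW => k; rewrite cabs_ge0 /=.
  by have := cabs_le_ReIm (u k - (lr +i* li)%C); rewrite ReB ImB.
- exact: cvg_cst.
- rewrite -[X in _ --> X](addr0 0); apply: cvgD.
    rewrite -(normr0 R) -(subrr lr); apply: cvg_norm.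
    by apply: cvgB; [exact: Hr | exact: cvg_cst].
  rewrite -(normr0 R) -(subrr li); apply: cvg_norm.
  by apply: cvgB; [exact: Hi | exact: cvg_cst].
Qed.

Lemma geometric_limit_error (u : nat -> R[i]) (l : R[i]) (M rho : R) :
  0 <= rho -> rho < 1 -> (forall k, cabs (u k.+1 - u k) <= M * rho ^+ k) ->
  cabs (u k - l) @[k --> \oo] --> (0 : R) -> cabs (u 0%N - l) <= M / (1 - rho).
Proof.
move=> r0 r1 H cvl; apply/ler_addgt0Pr => e e0.
have /cvgr0Pnorm_le/(_ _ e0)[m _ /(_ m (leqnn m)) /= He] := cvl.
rewrite ger0_norm ?cabs_ge0 // in He.
apply: le_trans (cabs_tri _ (u m) _) _; apply: lerD He.
have M0 : 0 <= M by have := H 0%N; rewrite expr0 mulr1; exact/le_trans/cabs_ge0.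
have rp : 0 < 1 - rho by rewrite subr_gt0.
apply: (@le_trans _ _ (M * (1 - rho ^+ m) / (1 - rho))); last first.
  by rewrite ler_pM2r ?invr_gt0 // ler_piMr // lerBlDr lerDl exprn_ge0.
elim: m => [|m IH]; first by rewrite subrr cabs0 expr0 subrr mulr0 mul0r.
apply: le_trans (cabs_tri _ (u m) _) _; rewrite [X in _ + X]cabs_distC.
apply: le_trans (lerD IH (H m)) _; rewrite exprS le_eqVlt; apply/orP; left.
by apply/eqP; field; rewrite gt_eqF.
Qed.

End ComplexSequences.

Lemma cvg_row (R : realType) (n : nat) (u : nat -> 'rV[R[i]]_n)
    (l : 'rV[R[i]]_n) :
  (forall i, cabs (u k 0 i - l 0 i) @[k --> \oo] --> (0 : R)) ->
  (u : nat -> 'rV[R[i]^o]_n) @ \oo --> (l : 'rV[R[i]^o]_n).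
Proof.
move=> H; apply/cvg_ballP => e e0.
have Hi (i : 'I_n) : \forall k \near \oo,
    ball (l 0 i : R[i]^o) e (u k 0 i : R[i]^o).
  by have /cvg_cabsP/cvg_ballP := H i; apply.
have Hall := @filter_forall _ _
  (fun i => [set k | ball (l 0 i : R[i]^o) e (u k 0 i : R[i]^o)]) \oo
  eventually_filter Hi.
by apply: (filterS _ Hall) => k Hk; split=> // i j; rewrite ord1; exact: Hk.
Qed.

(** * Root-vectors *)

Section RootVector.

(** Passing to the limit in the Lagrange expansion: when the nodes converge and
    the corrections vanish, only the product of linear factors survives. *)
Lemma expansion_limit (K : numFieldType) (n : nat) (zs ws : 'I_n -> nat -> K)
    (xi : 'I_n -> K) (c x : K) :
  (forall j, zs j @ \oo --> xi j) -> (forall j, ws j @ \oo --> (0 : K)) ->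
  (forall k, c = \prod_(j < n) (x - zs j k) +
     \sum_(i < n) ws i k * \prod_(j < n | j != i) (x - zs j k)) ->
  c = \prod_(j < n) (x - xi j).
Proof.
move=> zsxi ws0 cE.
have cvgP (A : pred 'I_n) :
    (fun k => \prod_(j < n | A j) (x - zs j k)) @ \oo -->
    \prod_(j < n | A j) (x - xi j).
  apply: cvg_big => [|j _]; first exact: mul_continuous.
  by apply: cvgB; [exact: cvg_cst | exact: zsxi].
have : (fun=> c) @ \oo --> \prod_(j < n) (x - xi j) + 0.
  rewrite (_ : (fun=> c) = fun k : nat => \prod_(j < n) (x - zs j k) +
     \sum_(i < n) ws i k * \prod_(j < n | j != i) (x - zs j k)); last first.
    by apply/funext => k; rewrite -cE.
  apply: cvgD; first exact: cvgP.
  rewrite [X in _ --> X](_ : 0 =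
    \sum_(i < n) 0 * \prod_(j < n | j != i) (x - xi j)); last first.
    by rewrite big1 // => i _; rewrite mul0r.
  apply: cvg_big => [|i _]; first exact: add_continuous.
  by apply: cvgM; [exact: ws0 | exact: cvgP].
rewrite addr0; apply: cvg_unique; first exact: norm_hausdorff.
exact: cvg_cst.
Qed.

Lemma root_vectorP (R : realType) (n : nat) (f : {poly R[i]})
    (xi : 'rV[R[i]]_n) :
  (forall x, f.[x] = \prod_(j < n) (x - xi 0 j)) -> root_vector f xi.
Proof.
move=> fE.
have -> : f = \prod_(c <- codom (xi 0)) ('X - c%:P).
  rewrite /codom big_image /=; set Q := \prod_(j < n) _.
  apply/eqP; rewrite -subr_eq0; apply/eqP.
  (* More distinct points than the degree of the difference allows. *)
  pose rs := [seq i%:R : R[i] | i <- iota 0 (size (f - Q))].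
  apply: (@roots_geq_poly_eq0 _ _ rs).
  - apply/allP => c _; apply/rootP; rewrite hornerD hornerN fE horner_prod.
    by under eq_bigr => j _ do rewrite hornerXsubC; rewrite subrr.
  - rewrite map_inj_uniq ?iota_uniq // => i j /eqP.
    by rewrite eqr_nat => /eqP.
  - by rewrite size_map size_iota.
move=> c; rewrite mu_prod_XsubC -sum1_count /codom /image_mem big_map
  big_enum_cond.
by rewrite -sum1_card; apply: eq_bigl => i; rewrite !inE.
Qed.

End RootVector.

(** * The iteration *)

Section Iteration.
Variables (R : realType) (n : nat) (f : {poly R[i]}) (p q : \bar R).
Hypotheses (n2 : (2 <= n)%N) (fmonic : f \is monic) (fsize : size f = n.+1).
Hypotheses (p1 : (1 <= p)%E) (pq : (p^-1 + q^-1 = 1)%E).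
Let a : R := n.-1%:R `^ fine (q^-1)%E.
Let b : R := 2 `^ fine (q^-1)%E.
Implicit Types z xi : 'rV[R[i]]_n.

Let a1 : 1 <= a := ge1_a n2 p1 pq.
Let b1 : 1 <= b := ge1_b p1 pq.
Local Notation E := (Efun f p).
Local Notation W := (weierstrass f).
Local Notation theta z := (psi a b (E z)).
Local Notation lambda z := (phi n a b (E z)).

(** The hypotheses on a starting point. They are inherited by the iterates, so
    that every bound proved for a starting point holds at each iterate. *)
Definition admissible z :=
  [/\ distinct_components z, (a + b) * E z < 1 & lambda z <= 1].

Lemma Efun_ge0 z : 0 <= E z. Proof. exact: pnorm_ge0 p1 pq _ _. Qed.

Lemma lambda_ge0 z : admissible z -> 0 <= lambda z.
Proof. by case=> _ abz _; apply: phi_nonneg => //; exact: Efun_ge0. Qed.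

Lemma theta_gt0 z : admissible z -> 0 < theta z.
Proof. by case=> _ abz _; have /andP[] := psi_bounds b1 (Efun_ge0 z) abz. Qed.

Lemma theta_lambda_lt1 z : admissible z -> theta z * lambda z < 1.
Proof. by case=> _ abz phz; apply: psi_phi_lt1 => //; exact: Efun_ge0. Qed.

Lemma mu_ge0 z : admissible z -> 0 <= mu a (E z).
Proof.
case=> _ abz _; have [_ _ ?] := subr_ab_gt0 b1 (Efun_ge0 z) abz.
by rewrite invr_ge0 ltW.
Qed.

Lemma admissible_shrink z y s : admissible z -> distinct_components y ->
  0 <= s -> s <= 1 -> E y <= s * E z -> admissible y.
Proof.
move=> az dy s0 s1 H; have [dz abz phz] := az.
have Hyz : E y <= E z by apply: le_trans H _; rewrite ler_piMl ?Efun_ge0.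
split=> //; first exact: (aby_lt1 a1 b1 Hyz abz).
apply: le_trans (phi_scale n a1 b1 (Efun_ge0 y) Hyz abz H) _.
by rewrite mulr_ile1 ?exprn_ge0 ?lambda_ge0 ?expr_le1.
Qed.

Lemma admissible_ehrlich z : admissible z -> admissible (ehrlich f z).
Proof.
move=> az; have [dz abz phz] := az.
apply: (admissible_shrink az) (lambda_ge0 az) phz _.
  exact: (ehrlich_distinct n2 fmonic fsize p1 pq).
exact: (ehrlich_Efun n2 fmonic fsize p1 pq).
Qed.

Lemma admissible_iter z m : admissible z -> admissible (iter m (ehrlich f) z).
Proof. by move=> az; elim: m => //= m IH; exact: admissible_ehrlich. Qed.

Lemma pow3_half m : (3 ^ m = (3 ^ m - 1) %/ 2 * 2 + 1)%N.
Proof.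
have : odd (3 ^ m) by rewrite oddX orbT.
by move: (3 ^ m)%N => N; lia.
Qed.

Lemma half_pow3S m : ((3 ^ m.+1 - 1) %/ 2 = (3 ^ m - 1) %/ 2 + 3 ^ m)%N.
Proof.
by have := pow3_half m; have := pow3_half m.+1; rewrite expnS; lia.
Qed.

Lemma leq_half_pow3 m : (m <= (3 ^ m - 1) %/ 2)%N.
Proof.
by elim: m => // m IH; rewrite half_pow3S; have := expn_gt0 3 m; lia.
Qed.

(** The quadratic scaling of [phi], applied with the factor
    [lambda ^+ ((3 ^ m - 1) / 2)], gives the exponent [3 ^ m - 1], to which the
    value at the starting point adds one. *)
Lemma Efun_iter z m : admissible z ->
  E (iter m (ehrlich f) z) <= lambda z ^+ ((3 ^ m - 1) %/ 2) * E z ->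
  lambda (iter m (ehrlich f) z) <= lambda z ^+ (3 ^ m) /\
  theta (iter m (ehrlich f) z) * lambda (iter m (ehrlich f) z) <=
    theta z * lambda z ^+ (3 ^ m).
Proof.
move=> az Hm; have [dz abz phz] := az.
set e := ((3 ^ m - 1) %/ 2)%N in Hm; set y := iter m _ _ in Hm *.
have lz := lambda_ge0 az.
have Hyz : E y <= E z.
  by apply: le_trans Hm _; rewrite ler_piMl ?Efun_ge0 ?exprn_ile1.
have p3 : lambda z ^+ (3 ^ m) = (lambda z ^+ e) ^+ 2 * lambda z.
  by rewrite -exprM -exprSr; congr (_ ^+ _); rewrite [LHS]pow3_half addn1.
rewrite p3; split; first exact: (phi_scale n a1 b1 (Efun_ge0 y) Hyz abz Hm).
rewrite [leRHS]mulrCA.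
exact: (psi_phi_scale n a1 b1 (Efun_ge0 y) Hyz abz Hm).
Qed.

Lemma Efun_iter_le z m : admissible z ->
  E (iter m (ehrlich f) z) <= lambda z ^+ ((3 ^ m - 1) %/ 2) * E z.
Proof.
move=> az; elim: m => [|m IH]; first by rewrite expn0 subnn div0n expr0 mul1r.
have [_ abm _] := admissible_iter m az; have [dm _ _] := admissible_iter m az.
rewrite iterS; apply: le_trans (ehrlich_Efun n2 fmonic fsize p1 pq dm abm) _.
rewrite half_pow3S addnC exprD -mulrA.
have [Hl _] := Efun_iter az IH.
apply: ler_pM => //; last exact: Efun_ge0.
exact: lambda_ge0 (admissible_iter m az).
Qed.

Lemma theta_lambda_iter_le z m : admissible z ->
  theta (iter m (ehrlich f) z) * lambda (iter m (ehrlich f) z) <=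
    theta z * lambda z ^+ (3 ^ m).
Proof. by move=> az; have [] := Efun_iter az (Efun_iter_le m az). Qed.

Lemma weierstrass_iter_le z m i : admissible z ->
  cabs (W (iter m (ehrlich f) z) 0 i) <=
  theta z ^+ m * lambda z ^+ ((3 ^ m - 1) %/ 2) * cabs (W z 0 i).
Proof.
move=> az; elim: m => [|m IH].
  by rewrite expn0 subnn div0n !expr0 !mul1r.
have am := admissible_iter m az; have [dm abm _] := am.
rewrite iterS.
apply: le_trans (ehrlich_weierstrass n2 fmonic fsize p1 pq dm abm i) _.
have -> : theta z ^+ m.+1 * lambda z ^+ ((3 ^ m.+1 - 1) %/ 2) * cabs (W z 0 i) =
  (theta z * lambda z ^+ (3 ^ m)) *
  (theta z ^+ m * lambda z ^+ ((3 ^ m - 1) %/ 2) * cabs (W z 0 i)).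
  by rewrite half_pow3S exprD exprS; ring.
apply: ler_pM => //; rewrite ?cabs_ge0 //; last exact: theta_lambda_iter_le.
by rewrite mulr_ge0 ?lambda_ge0 // ltW // theta_gt0.
Qed.

(** Cruder than [weierstrass_iter_le], but summable as a geometric series. *)
Lemma weierstrass_iter_geometric z m i : admissible z ->
  cabs (W (iter m (ehrlich f) z) 0 i) <=
  cabs (W z 0 i) * (theta z * lambda z) ^+ m.
Proof.
move=> az; apply: le_trans (weierstrass_iter_le m i az) _.
rewrite mulrC (exprMn _ (theta z)); apply: ler_wpM2l; first exact: cabs_ge0.
apply: ler_wpM2l; first by rewrite exprn_ge0 // ltW // theta_gt0.
have [_ _ phz] := az.
by apply: ler_wiXn2l; rewrite ?lambda_ge0 // leq_half_pow3.
Qed.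

Lemma Efun_iter_le_start z m : admissible z -> E (iter m (ehrlich f) z) <= E z.
Proof.
move=> az; apply: le_trans (Efun_iter_le m az) _.
by have [_ _ phz] := az; rewrite ler_piMl ?Efun_ge0 ?exprn_ile1 ?lambda_ge0.
Qed.

Lemma displacement_iter z m i : admissible z ->
  cabs (iter m.+1 (ehrlich f) z 0 i - iter m (ehrlich f) z 0 i) <=
  mu a (E z) * cabs (W z 0 i) * (theta z * lambda z) ^+ m.
Proof.
move=> az; have [dm abm _] := admissible_iter m az.
rewrite iterS.
apply: le_trans (ehrlich_displacement n2 fmonic fsize p1 pq dm abm i) _.
rewrite -mulrA; apply: ler_pM; rewrite ?cabs_ge0 ?weierstrass_iter_geometric //.
  exact: mu_ge0 (admissible_iter m az).
have [_ abz _] := az.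
by apply: (mu_le a1 b1) => //; [exact: Efun_ge0 | exact: Efun_iter_le_start].
Qed.

Let rate_ge0 z : admissible z -> 0 <= theta z * lambda z.
Proof. by move=> az; rewrite mulr_ge0 ?lambda_ge0 // ltW // theta_gt0. Qed.

(** Sum of the geometric series that bounds the remaining displacements. *)
Lemma ehrlich_error z i l : admissible z ->
  cabs (iter k (ehrlich f) z 0 i - l) @[k --> \oo] --> (0 : R) ->
  cabs (z 0 i - l) <= mu a (E z) / (1 - theta z * lambda z) * cabs (W z 0 i).
Proof.
move=> az H.
have := geometric_limit_error (rate_ge0 az) (theta_lambda_lt1 az)
  (fun m => displacement_iter m i az) H.
by rewrite mulrAC.
Qed.

(** * The limit and the order of convergence *)

Section Limit.
Variables (z xi : 'rV[R[i]]_n).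
Hypothesis az : admissible z.
Hypothesis zxi : forall i,
  cabs (iter k (ehrlich f) z 0 i - xi 0 i) @[k --> \oo] --> (0 : R).
Local Notation zk k := (iter k (ehrlich f) z).

Lemma ehrlich_error_iter k i : cabs (zk k 0 i - xi 0 i) <=
  mu a (E (zk k)) / (1 - theta (zk k) * lambda (zk k)) * cabs (W (zk k) 0 i).
Proof.
apply: ehrlich_error; first exact: admissible_iter.
have := zxi i; rewrite -(cvg_shiftn k) /=.
by under eq_fun => m do rewrite iterD.
Qed.

Lemma horner_limit x : f.[x] = \prod_(j < n) (x - xi 0 j).
Proof.
apply: (@expansion_limit R[i] n (fun j k => zk k 0 j)
  (fun j k => W (zk k) 0 j)).
- by move=> j; apply/cvg_cabsP; exact: zxi.
- move=> j; apply/cvg_cabsP.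
  apply: (@squeeze_cvgr _ _ _ _ (fun=> 0)
    (geometric (cabs (W z 0 j)) (theta z * lambda z))).
  + by apply: nearW => k; rewrite subr0 cabs_ge0 weierstrass_iter_geometric.
  + exact: cvg_cst.
  + by apply: cvg_geometric; rewrite ger0_norm ?rate_ge0 ?theta_lambda_lt1.
- move=> k; have [dk _ _] := admissible_iter k az.
  rewrite (horner_weierstrass_expansion fmonic fsize dk); congr (_ + _).
  by apply: eq_bigr => i _; rewrite mxE.
Qed.

Lemma limit_root_vector : root_vector f xi.
Proof. exact/root_vectorP/horner_limit. Qed.

Let c := mu a (E z) / (1 - theta z * lambda z).

Let c_ge0 : 0 <= c.
Proof. by rewrite divr_ge0 ?mu_ge0 // subr_ge0 ltW // theta_lambda_lt1. Qed.

Let error_le k i : cabs (zk k 0 i - xi 0 i) <= c * cabs (W (zk k) 0 i).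
Proof.
apply: le_trans (ehrlich_error_iter k i) _; apply: ler_wpM2r;
  first exact: cabs_ge0.
have ak := admissible_iter k az; have [_ abz phz] := az.
have EE := Efun_iter_le_start k az.
apply: ler_pM; rewrite ?mu_ge0 //.
- by rewrite invr_ge0 subr_ge0 ltW // theta_lambda_lt1.
- exact: (mu_le a1 b1 (Efun_ge0 _) EE abz).
- rewrite lef_pV2 ?posrE ?subr_gt0 ?theta_lambda_lt1 // lerD2l lerN2.
  apply: le_trans (theta_lambda_iter_le k az) _.
  apply: ler_wpM2l; first by rewrite ltW ?theta_gt0.
  by rewrite -[leRHS]expr1; apply: ler_wiXn2l; rewrite ?lambda_ge0 ?expn_gt0.
Qed.

Let pair_error_le k i j : j != i ->
  cabs (zk k 0 i - xi 0 i) + cabs (zk k 0 j - xi 0 j) <=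
  c * (b * E z) * cabs (zk k 0 i - zk k 0 j).
Proof.
move=> ji; have [dk _ _] := admissible_iter k az.
apply: le_trans (lerD (error_le k i) (error_le k j)) _.
rewrite -mulrDr -mulrA; apply: (ler_wpM2l c_ge0).
apply: le_trans (weierstrass_pair_le_Efun f n2 p1 pq dk ji) _.
apply: ler_wpM2r; first exact: cabs_ge0.
by rewrite ler_wpM2l ?(le_trans _ b1) ?Efun_iter_le_start.
Qed.

Hypothesis phi_lt1 : lambda z < 1.

(** If [xi i = xi j], the errors of components [i] and [j] at the starting point
    would add up to at least their distance, against [error_factor_lt1]. *)
Lemma limit_distinct : distinct_components xi.
Proof.
move=> i j xij; apply/eqP; rewrite eq_sym; apply: contraT => ji.
have [dz abz _] := az.
have := pair_error_le 0 ji; rewrite /= xij (cabs_distC (z 0 j)).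
move=> /(le_trans (cabs_tri (z 0 i) (xi 0 j) (z 0 j))); rewrite leNgt.
rewrite gtr_pMl ?(error_factor_lt1 b1 (Efun_ge0 z)) //.
by rewrite cabs_gt0 subr_eq0 (inj_eq dz) eq_sym.
Qed.

Let M := (1 + c * E z) ^+ n.-1.

Let M_ge0 : 0 <= M.
Proof. by rewrite exprn_ge0 // addr_ge0 // mulr_ge0 ?Efun_ge0. Qed.

(** [f] splits over the components of [xi], so [W i] is [z i - xi i] times the
    quotients of [z i - xi j] by [z i - z j], each at most [1 + c * E z] in
    modulus. *)
Let weierstrass_le_error k i :
  cabs (W (zk k) 0 i) <= M * cabs (zk k 0 i - xi 0 i).
Proof.
have [dk _ _] := admissible_iter k az.
rewrite mxE horner_limit (bigD1 i) //= -mulrA mulrC -prodfV -big_split /= cabsM.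
apply: ler_wpM2r; first exact: cabs_ge0.
rewrite cabs_prod.
have -> : M = \prod_(j in predC1 i) (1 + c * E z).
  by rewrite prodr_const cardC1 card_ord.
apply: ler_prod => j ji; rewrite cabs_ge0 cabsM cabsV.
have ij : i != j by rewrite eq_sym.
have d0 : 0 < cabs (zk k 0 i - zk k 0 j).
  by rewrite cabs_gt0 subr_eq0 (inj_eq dk).
rewrite ler_pdivrMr // mulrDl mul1r.
apply: le_trans (cabs_tri _ (zk k 0 j) _) _; rewrite lerD2l.
apply: le_trans (error_le k j) _; rewrite -[leRHS]mulrA;
  apply: (ler_wpM2l c_ge0).
apply: le_trans (weierstrass_le_Efun f n2 p1 pq dk ij) _.
rewrite cabs_distC; apply: ler_wpM2r; first exact: cabs_ge0.
exact: Efun_iter_le_start.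
Qed.

Let D := (1 + c * (b * E z)) * \sum_(i < n) (sep xi i)^-1.

Let cbE_ge0 : 0 <= c * (b * E z).
Proof.
apply: mulr_ge0 => //; apply: mulr_ge0; last exact: Efun_ge0.
exact: le_trans b1.
Qed.

Let D_ge0 : 0 <= D.
Proof.
apply: mulr_ge0; first exact: addr_ge0.
by apply: sumr_ge0 => i _; rewrite invr_ge0 ltW // sep_gt0 //;
  exact: limit_distinct.
Qed.

(** The iterates stay separated because their limit is. The sum of the inverses
    over all components is a bound uniform in [i]. *)
Let sep_inv_le k i : (sep (zk k) i)^-1 <= D.
Proof.
have [dk _ _] := admissible_iter k az.
have sx j : 0 < sep xi j by apply: sep_gt0 => //; exact: limit_distinct.
have B0 : 0 < 1 + c * (b * E z) by rewrite ltr_pwDl.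
apply: (@le_trans _ _ ((1 + c * (b * E z)) / sep xi i)); last first.
  rewrite /D; apply: ler_wpM2l; first exact: ltW.
  rewrite (bigD1 i) //= lerDl; apply: sumr_ge0 => j _.
  by rewrite invr_ge0 ltW.
rewrite -[leRHS]invrK lef_pV2 ?posrE ?sep_gt0 ?invr_gt0 ?divr_gt0 //.
rewrite invf_div ler_pdivrMr // mulrC -ler_pdivrMl //.
apply: le_sep => // j ji; rewrite mulrC ler_pdivrMr // mulrC mulrDl mul1r.
apply: le_trans (sep_le xi ji) _.
apply: le_trans (cabs_tri _ (zk k 0 i) _) _.
apply: le_trans (lerD (lexx _) (cabs_tri _ (zk k 0 j) _)) _.
rewrite addrCA lerD2l (cabs_distC (xi 0 i)); exact: pair_error_le.
Qed.

Let Efun_le_error k : E (zk k) <= D * (M * pnorm p (zk k - xi)).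
Proof.
have [dk _ _] := admissible_iter k az.
have H := Efun_le_pnorm_weierstrass f n2 p1 pq dk D_ge0 (sep_inv_le k).
apply: le_trans H _.
apply: (ler_wpM2l D_ge0); apply: (pnorm_le p1 pq M_ge0) => i.
have -> : (zk k - xi) 0 i = zk k 0 i - xi 0 i by rewrite !mxE.
exact: weierstrass_le_error.
Qed.

(** The next error is at most [c * psi * phi] times the current correction, and
    [psi * phi] is quadratic in [E]; both [E] and the correction are bounded by
    multiples of the current error, whence the cube. *)
Lemma ehrlich_order_three :
  has_order_of_convergence p (fun k => zk k) xi 3.
Proof.
have [_ abz _] := az.
pose H := growth n a b (E z) / (1 - a * E z).
have H0 : 0 <= H.
  have [_ _ h] := subr_ab_gt0 b1 (Efun_ge0 z) abz.
  by apply: divr_ge0 (ltW h); apply: growth_ge0 => //; exact: Efun_ge0.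
exists (c * (H * (D * M) ^+ 2 * M)); apply: nearW => k.
have ak := admissible_iter k az; have [dk abk _] := ak.
set P := pnorm p (zk k - xi).
have P0 : 0 <= P by exact: pnorm_ge0 p1 pq _ _.
have -> : c * (H * (D * M) ^+ 2 * M) * P ^+ 3 =
  c * (H * (D * (M * P)) ^+ 2 * M) * P by ring.
have DMP0 : 0 <= D * (M * P) by apply: mulr_ge0 => //; exact: mulr_ge0.
apply: (pnorm_le p1 pq) => [|i].
  apply: mulr_ge0 c_ge0 _; apply: mulr_ge0 M_ge0.
  by apply: mulr_ge0 H0 _; exact: exprn_ge0.
have subE m : (zk m - xi) 0 i = zk m 0 i - xi 0 i by rewrite !mxE.
rewrite !subE; have := error_le k.+1 i.
move=> /le_trans; apply; rewrite -[leRHS]mulrA; apply: (ler_wpM2l c_ge0).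
apply: le_trans (ehrlich_weierstrass n2 fmonic fsize p1 pq dk abk i) _.
rewrite -[leRHS]mulrA; apply: ler_pM; rewrite ?cabs_ge0 ?rate_ge0 //.
have Ek := Efun_iter_le_start k az.
apply: le_trans (psi_phi_le_sq n a1 b1 (Efun_ge0 _) Ek abz) _.
rewrite -/H mulrC; apply: (ler_wpM2l H0).
by rewrite lerXn2r ?nnegrE ?Efun_ge0 ?Efun_le_error.
Qed.

End Limit.
End Iteration.

(** * The convergence theorem *)

Theorem theorem3p1 (R : realType) (n : nat) (f : {poly R[i]}) (p q : \bar R)
    (z0 : 'rV[R[i]]_n) :
  (2 <= n)%N -> f \is monic -> size f = n.+1 ->
  (1 <= p)%E -> (p^-1 + q^-1 = 1)%E ->
  let a : R := n.-1%:R `^ fine q^-1 in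
  let b : R := 2 `^ fine q^-1 in
  let E := Efun f p in
  let W := weierstrass f in
  let z := fun k : nat => iter k (ehrlich f) z0 in
  distinct_components z0 ->
  E z0 < 1 / (a + b) ->
  phi n a b (E z0) <= 1 ->
  (forall k, ehrlich_defined f (z k)) /\
  exists xi : 'rV[R[i]]_n,
    [/\ root_vector f xi,
        (z : nat -> 'rV[R[i]^o]_n) @ \oo --> (xi : 'rV[R[i]^o]_n),
        phi n a b (E z0) < 1 -> has_order_of_convergence p z xi 3,
        (forall k, (1 <= k)%N ->
          let lambda := phi n a b (E z0) in
          let theta := psi a b (E z0) in
          let A := mu a (E z0 * lambda ^+ ((3 ^ k - 1) %/ 2)) in
          pnorm p (z k - xi) <=
            A * (theta ^+ k * lambda ^+ ((3 ^ k - 1) %/ 2)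
                 / (1 - theta * lambda ^+ (3 ^ k))) * pnorm p (W z0)) &
        (forall k,
          let lambda := phi n a b (E (z k)) in
          let theta := psi a b (E (z k)) in
          pnorm p (z k - xi) <=
            mu a (E (z k)) / (1 - theta * lambda) * pnorm p (W (z k)))].
Proof.
move=> n2 fmonic fsize p1 pq a b E W z dz Ez phz.
have a1 : 1 <= a := ge1_a n2 p1 pq.
have b1 : 1 <= b := ge1_b p1 pq.
have abz : (a + b) * E z0 < 1.
  have ab0 : 0 < a + b by lra.
  by rewrite mulrC -ltr_pdivlMr.
have az : admissible f p q z0 by split.
have azk k : admissible f p q (z k) by exact: admissible_iter.
split=> [k|].
  by have [dk abk _] := azk k; exact: (ehrlich_definedP n2 fmonic fsize p1 pq).
have /choice[l zl] i : exists l, cabs (z k 0 i - l) @[k --> \oo] --> (0 : R).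
  have rho1 := theta_lambda_lt1 p1 pq az.
  apply: (complex_geometric_cvg (u := fun k => z k 0 i) _ rho1).
    by rewrite mulr_ge0 ?(lambda_ge0 n2 p1 pq) // ltW // (theta_gt0 p1 pq).
  by move=> k; exact: (displacement_iter n2 fmonic fsize p1 pq k i az).
pose xi : 'rV[R[i]]_n := \row_i l i.
have zxi i : cabs (z k 0 i - xi 0 i) @[k --> \oo] --> (0 : R).
  by rewrite mxE; exact: zl.
have err k : pnorm p (z k - xi) <= mu a (E (z k)) /
    (1 - psi a b (E (z k)) * phi n a b (E (z k))) * pnorm p (W (z k)).
  apply: (pnorm_le p1 pq) => [|i].
    apply: divr_ge0; first exact: (mu_ge0 p1 pq).
    by rewrite subr_ge0 ltW // (theta_lambda_lt1 p1 pq).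
  rewrite [X in cabs X <= _]mxE [X in _ + X]mxE.
  exact: (ehrlich_error_iter n2 fmonic fsize p1 pq az zxi).
exists xi; split.
- exact: (limit_root_vector n2 fmonic fsize p1 pq az zxi).
- exact: cvg_row.
- exact: (ehrlich_order_three n2 fmonic fsize p1 pq az zxi).
- move=> k _; cbv zeta; set lambda := phi n a b (E z0).
  set theta := psi a b (E z0); set e := ((3 ^ k - 1) %/ 2)%N.
  have l0 : 0 <= lambda by exact: (lambda_ge0 n2 p1 pq).
  have E0 w : 0 <= E w by exact: (Efun_ge0 f p1 pq _).
  have t0 : 0 <= theta by rewrite ltW // (theta_gt0 p1 pq az).
  have Ek : E (z k) <= E z0 * lambda ^+ e.
    by rewrite mulrC; exact: (Efun_iter_le n2 fmonic fsize p1 pq k az).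
  have le1 : E z0 * lambda ^+ e <= E z0 by rewrite ler_piMr // exprn_ile1.
  apply: le_trans (err k) _; rewrite -[leRHS]mulrA.
  have tl1 w : admissible f p q w -> psi a b (E w) * phi n a b (E w) < 1.
    exact: (theta_lambda_lt1 p1 pq).
  have tlk := theta_lambda_iter_le n2 fmonic fsize p1 pq k az.
  have tl0 : theta * lambda ^+ (3 ^ k) < 1.
    apply: le_lt_trans (tl1 _ az); apply: ler_wpM2l => //.
    by rewrite -[leRHS]expr1; apply: ler_wiXn2l; rewrite ?expn_gt0.
  rewrite -[leLHS]mulrA; apply: ler_pM.
  + exact: (mu_ge0 p1 pq).
  + apply: mulr_ge0; last exact: (pnorm_ge0 p1 pq).
    by rewrite invr_ge0 subr_ge0 ltW // tl1.
  + exact: (mu_le a1 b1 (E0 _) Ek (aby_lt1 a1 b1 le1 abz)).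
  rewrite [leRHS]mulrAC [leLHS]mulrC; apply: ler_pM.
  + exact: (pnorm_ge0 p1 pq).
  + by rewrite invr_ge0 subr_ge0 ltW // tl1.
  + apply: (pnorm_le p1 pq) => [|i]; first by rewrite mulr_ge0 ?exprn_ge0.
    exact: (weierstrass_iter_le n2 fmonic fsize p1 pq).
  + by rewrite lef_pV2 ?posrE ?subr_gt0 ?tl1 // lerD2l lerN2.
- by move=> k; exact: err.
Qed.
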